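(* Let $b\in\mathbb{R}^n\setminus\mathbb{Z}^n$. Then $$Q_b=\operatorname{cl}(\operatorname{conv}(M_b))=\operatorname{conv}(M_b)+\big(\mathbb{R}^{(\mathbb{R}^n)}_+\times\mathbb{R}^{(\mathbb{R}^n)}_+\big).$$
   Context: $\mathbb{R}^{(\mathbb{R}^n)}$ is the real vector space of functions $\mathbb{R}^n\to\mathbb{R}$ with finite support, and $\mathbb{R}^{(\mathbb{R}^n)}_+$ is the subset of its nonnegative functions. $M_b$ is the set of all pairs $(s,y)$ of finite-support functions $s:\mathbb{R}^n\to\mathbb{R}_+$, $y:\mathbb{R}^n\to\mathbb{Z}_+$ (nonnegative integer values) such that $\sum_{r\in\mathbb{R}^n} r\,s(r)+\sum_{p\in\mathbb{R}^n}p\,y(p)\in b+\mathbb{Z}^n$; it is a subset of $\mathbb{R}^{(\mathbb{R}^n)}\times\mathbb{R}^{(\mathbb{R}^n)}$. For $\psi,\pi:\mathbb{R}^n\to\mathbb{R}$ and $\alpha\in\mathbb{R}$ let $H_{\psi,\pi,\alpha}=\{(s,y)\in\mathbb{R}^{(\mathbb{R}^n)}\times\mathbb{R}^{(\mathbb{R}^n)}:\sum_{r}\psi(r)s(r)+\sum_{p}\pi(p)y(p)\ge\alpha\}$. The tuple $(\psi,\pi,\alpha)$ is a valid tuple for $M_b$ if $M_b\subseteq H_{\psi,\pi,\alpha}$; by positive rescaling it is assumed that $\alpha\in\{-1,0,1\}$. $Q_b$ denotes the intersection of $\mathbb{R}^{(\mathbb{R}^n)}_+\times\mathbb{R}^{(\mathbb{R}^n)}_+$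 with all $H_{\psi,\pi,\alpha}$ for $(\psi,\pi,\alpha)$ a valid tuple for $M_b$. $\operatorname{conv}$ is the convex hull, and $\operatorname{cl}$ is the closure in the topology induced by the norm $|(s,y)|_*=|s(0)|+\sum_{r}\|r\||s(r)|+|y(0)|+\sum_{p}\|p\||y(p)|$ on $\mathbb{R}^{(\mathbb{R}^n)}\times\mathbb{R}^{(\mathbb{R}^n)}$, where $\|\cdot\|$ is the usual (Euclidean) norm on $\mathbb{R}^n$. *)

(* Defs.v *)
From HB Require Import structures.
From mathcomp Require Import all_boot all_order all_algebra.
From mathcomp Require Import finmap.
From mathcomp Require Import all_classical all_reals all_analysis.

Set Implicit Arguments.
Unset Strict Implicit.
Unset Printing Implicit Defensive.

Import Order.TTheory GRing.Theory Num.Theory.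
Import numFieldNormedType.Exports.

Local Open Scope classical_set_scope.
Local Open Scope ring_scope.

(* The real vector space R^(T) of functions T -> R with finite support, as a
   subspace of T -> R. *)
Definition has_fsupp (T : choiceType) (R : realType) : {pred T -> R} :=
  fun f => `[< finite_set (f @^-1` [set~ 0]) >].

Record fsupp (T : choiceType) (R : realType) := FSupp {
  fsupp_fun :> T -> R;
  _ : fsupp_fun \in @has_fsupp T R
}.

HB.instance Definition _ (T : choiceType) (R : realType) :=
  [isSub for @fsupp_fun T R].
HB.instance Definition _ (T : choiceType) (R : realType) :=
  [Choice of fsupp T R by <:].

Lemma has_fsupp_submod_closed (T : choiceType) (R : realType) :
  submod_closed (@has_fsupp T R).
Proof.
split=> [|a f g /asboolP finf /asboolP fing]; apply/asboolP.
  by rewrite (_ : _ @^-1` _ = set0)//; apply/seteqP; split => x //= /(_ erefl).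
apply: (@sub_finite_set _ _ (f @^-1` [set~ 0] `|` g @^-1` [set~ 0])).
  move=> x /= afgx; apply/not_andP => -[f0 g0]; apply: afgx.
  by rewrite addrfctE scalrfctE f0 g0 scaler0 addr0.
by rewrite finite_setU.
Qed.

HB.instance Definition _ (T : choiceType) (R : realType) :=
  GRing.isSubmodClosed.Build R (T -> R) (@has_fsupp T R)
    (@has_fsupp_submod_closed T R).
HB.instance Definition _ (T : choiceType) (R : realType) :=
  [SubChoice_isSubLmodule of fsupp T R by <:].

Lemma fsuppP (T : choiceType) (R : realType) (f : fsupp T R) :
  finite_set (f @^-1` [set~ 0]).
Proof. by case: f => f /= /asboolP. Qed.

(* The library norm on 'rV[R]_n is the max norm. *)
Definition enorm (R : realType) (n : nat) (x : 'rV[R]_n) : R :=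
  Num.sqrt (\sum_(i < n) x 0 i ^+ 2).

Lemma enorm_eq0 (R : realType) (n : nat) (x : 'rV[R]_n) :
  enorm x = 0 -> x = 0.
Proof.
move/eqP; rewrite sqrtr_eq0 => x0.
have /eqP : \sum_(i < n) x 0 i ^+ 2 = 0.
  by apply/eqP; rewrite eq_le x0 sumr_ge0// => i _; exact: sqr_ge0.
rewrite psumr_eq0 => [/allP x0'|i _]; last exact: sqr_ge0.
apply/rowP => i; rewrite mxE; apply/eqP.
by move: (x0' i); rewrite mem_index_enum sqrf_eq0; apply.
Qed.

Definition fsnorm (R : realType) (n : nat) (s : fsupp 'rV[R]_n R) : R :=
  `|s 0| + \sum_(r \in [set: 'rV[R]_n]) enorm r * `|s r|.

Lemma fsnormE (R : realType) (n : nat) (s : fsupp 'rV[R]_n R)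
    (A : {fset 'rV[R]_n}) : s @^-1` [set~ 0] `<=` [set` A] ->
  fsnorm s = `|s 0| + \sum_(r <- A) enorm r * `|s r|.
Proof.
move=> sA; congr (_ + _); apply: fsbigTE => r rA.
suff -> : s r = 0 by rewrite normr0 mulr0.
by apply: contrapT => sr; move/negP: rA; apply; exact: sA.
Qed.

Lemma fsnorm_ge0 (R : realType) (n : nat) (s : fsupp 'rV[R]_n R) :
  0 <= fsnorm s.
Proof.
by rewrite addr_ge0// fsumr_ge0// => r _; rewrite mulr_ge0// sqrtr_ge0.
Qed.

Lemma fsnormD (R : realType) (n : nat) (s t : fsupp 'rV[R]_n R) :
  fsnorm (s + t) <= fsnorm s + fsnorm t.
Proof.
pose U := s @^-1` [set~ 0] `|` t @^-1` [set~ 0].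
have /finite_fsetP[A UA] : finite_set U by rewrite finite_setU; split; apply: fsuppP.
rewrite !(@fsnormE _ _ _ A) -?UA; [|by right|by left|].
  rewrite addrACA -big_split lerD ?ler_normD//.
  apply: ler_sum => r _ /=; rewrite -mulrDr ler_wpM2l ?sqrtr_ge0//.
  exact: ler_normD.
move=> r /= str; apply/not_andP => -[s0 t0]; apply: str.
by rewrite /GRing.add/= s0 t0 addr0.
Qed.

Lemma fsnormZ (R : realType) (n : nat) (l : R) (s : fsupp 'rV[R]_n R) :
  fsnorm (l *: s) = `|l| * fsnorm s.
Proof.
have /finite_fsetP[A UA] := fsuppP s.
rewrite !(@fsnormE _ _ _ A) -?UA//.
  rewrite mulrDr mulr_sumr normrM; congr (_ + _); apply: eq_bigr => r _.
  by rewrite normrM mulrCA.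
by move=> r /= lsr s0; apply: lsr; rewrite (_ : _ r = l * s r)// s0 mulr0.
Qed.

Lemma fsnorm_eq0 (R : realType) (n : nat) (s : fsupp 'rV[R]_n R) :
  fsnorm s = 0 -> s = 0.
Proof.
have /finite_fsetP[A UA] := fsuppP s.
rewrite (@fsnormE _ _ _ A) -?UA// => /eqP.
have ge0 r : 0 <= enorm r * `|s r| by rewrite mulr_ge0// sqrtr_ge0.
rewrite paddr_eq0// ?sumr_ge0// normr_eq0 psumr_eq0//.
move=> /andP[/eqP s0 /allP sA]; apply/val_inj/funext => r /=.
apply: contrapT => sr.
have /sA : r \in A by have : [set` A] r by rewrite -UA.
rewrite /= mulf_eq0 normr_eq0 => /orP[/eqP/enorm_eq0 r0|/eqP//].
by apply: sr; rewrite r0.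
Qed.

(* R^(R^n) x R^(R^n), a type of its own so that its norm is |.|_* *)
Definition fspair (R : realType) (n : nat) : Type :=
  (fsupp 'rV[R]_n R * fsupp 'rV[R]_n R)%type.

HB.instance Definition _ (R : realType) (n : nat) :=
  GRing.Lmodule.copy (fspair R n)
    (fsupp 'rV[R]_n R * fsupp 'rV[R]_n R)%type.

Definition star_norm (R : realType) (n : nat) (x : fspair R n) : R :=
  `|x.1 0| + \sum_(r \in [set: 'rV[R]_n]) enorm r * `|x.1 r|
  + `|x.2 0| + \sum_(p \in [set: 'rV[R]_n]) enorm p * `|x.2 p|.

Lemma star_normE (R : realType) (n : nat) (x : fspair R n) :
  star_norm x = fsnorm x.1 + fsnorm x.2.
Proof. by rewrite /star_norm /fsnorm !addrA. Qed.

Lemma star_normD (R : realType) (n : nat) (x y : fspair R n) :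
  star_norm (x + y) <= star_norm x + star_norm y.
Proof. by rewrite !star_normE [leRHS]addrACA lerD ?fsnormD. Qed.

Lemma star_normZ (R : realType) (n : nat) (l : R) (x : fspair R n) :
  star_norm (l *: x) = `|l| * star_norm x.
Proof. by rewrite !star_normE [RHS]mulrDr -!fsnormZ. Qed.

Lemma star_norm_eq0 (R : realType) (n : nat) (x : fspair R n) :
  star_norm x = 0 -> x = 0.
Proof.
rewrite star_normE => /eqP; rewrite paddr_eq0 ?fsnorm_ge0//.
case: x => s y /= /andP[/eqP/fsnorm_eq0 -> /eqP/fsnorm_eq0 ->]; reflexivity.
Qed.

HB.instance Definition _ (R : realType) (n : nat) :=
  Lmodule_isNormed.Build R (fspair R n)
    (@star_normD R n) (@star_normZ R n) (@star_norm_eq0 R n).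

Definition convex_hull (R : realType) (E : lmodType R) (A : set E) : set E :=
  smallest (@convex_set R E) A.

Definition minkowski_sum (V : nmodType) (A B : set V) : set V :=
  [set x + y | x in A & y in B].

Definition Zn (R : realType) (n : nat) : set 'rV[R]_n :=
  [set x | x \is a mxOver Num.int].
Arguments Zn {R n}.

Definition nonneg_cone (R : realType) (n : nat) : set (fspair R n) :=
  [set x : fspair R n | (forall r, 0 <= x.1 r) /\ (forall p, 0 <= x.2 p)].
Arguments nonneg_cone {R n}.

Definition Mb (R : realType) (n : nat) (b : 'rV[R]_n) : set (fspair R n) :=
  [set x : fspair R n |
    [/\ forall r, 0 <= x.1 r,
        forall p, x.2 p \is a Num.nat &
        exists2 z, Zn z &
          \sum_(r \in [set: 'rV[R]_n]) x.1 r *: r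
          + \sum_(p \in [set: 'rV[R]_n]) x.2 p *: p = b + z]].

Definition halfspace (R : realType) (n : nat) (psi pi : 'rV[R]_n -> R)
    (alpha : R) : set (fspair R n) :=
  [set x : fspair R n |
    \sum_(r \in [set: 'rV[R]_n]) psi r * x.1 r
    + \sum_(p \in [set: 'rV[R]_n]) pi p * x.2 p >= alpha].

Definition valid_tuple (R : realType) (n : nat) (b : 'rV[R]_n)
    (psi pi : 'rV[R]_n -> R) (alpha : R) : Prop :=
  alpha \in [:: -1; 0; 1] /\ Mb b `<=` halfspace psi pi alpha.

Definition Qb (R : realType) (n : nat) (b : 'rV[R]_n) : set (fspair R n) :=
  nonneg_cone `&`
  [set x : fspair R n | forall psi pi alpha,
     valid_tuple b psi pi alpha -> halfspace psi pi alpha x].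

(* Main.v *)
From HB Require Import structures.
Require Import Defs.
From mathcomp Require Import all_boot all_order all_algebra.
From mathcomp Require Import finmap.
From mathcomp Require Import all_classical all_reals all_analysis.
From mathcomp Require Import ring lra.

(* Write K for conv(M_b) + (R_+ x R_+), and prove K <= cl conv(M_b) <= Q_b <= K.

   K <= cl conv(M_b): a point x of M_b may be moved N steps along any unit
   vector, the fractional part of the total being corrected by one continuous
   ray of bounded norm; averaging with x, with weight l / N on the moved point,
   gives x + l e up to an error O(1 / N).

   For a finite set A of directions let T be the linear map that fixes the
   coordinates in A and replaces every other direction r by the continuous rays
   |r_i| (+- e_i). T preserves M_b, because it preserves the total, and it fixes
   every x supported in A.

   cl conv(M_b) <= Q_b: the functional h of a valid tuple need not be
   continuous, but h o T is Lipschitz for the star norm; it is still >= alpha on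
   M_b, and it agrees with h at a given x supported in A.

   Q_b <= K: if x is not in K, take A containing its support and all +- e_i. In
   the finite-dimensional space of points supported in A, the points of M_b form
   a closed subset S of the orthant, and conv(S) + orthant is closed, so a
   linear functional w strictly separates x from it. Then w o T is a valid tuple
   that cuts off x. *)

Set Implicit Arguments.
Unset Strict Implicit.
Unset Printing Implicit Defensive.

Import Order.TTheory GRing.Theory Num.Theory.
Import numFieldNormedType.Exports.

Local Open Scope classical_set_scope.
Local Open Scope ring_scope.

(** * Convex combinations *)

(** The number [m] of points is a parameter because the closedness argument needs a fixed one.
    Weights may vanish and points may repeat. *)
Definition convex_comb (R : numDomainType) (V : lmodType R) (A : set V)
    (m : nat) : set V :=
  [set v | exists (l : 'I_m -> R) (s : 'I_m -> V),
    [/\ forall i, 0 <= l i, \sum_i l i = 1, forall i, A (s i) &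
        v = \sum_i l i *: s i]].

Lemma convex_comb_grow (R : numDomainType) (V : lmodType R) (A : set V) m :
  convex_comb A m `<=` convex_comb A m.+1.
Proof.
case: m => [|m] v [l [s [l0 l1 sA ->]]].
  by move: l1; rewrite big_ord0 => /esym/eqP; rewrite oner_eq0.
pose l' i := if unlift ord0 i is Some j then l j else 0.
pose s' i := if unlift ord0 i is Some j then s j else s ord0.
exists l', s'; split.
- by move=> i; rewrite /l'; case: unliftP.
- rewrite big_ord_recl /l' unlift_none add0r -l1.
  by apply: eq_bigr => i _; rewrite liftK.
- by move=> i; rewrite /s'; case: unliftP.
- rewrite [RHS]big_ord_recl /l' unlift_none scale0r add0r.
  by apply: eq_bigr => i _; rewrite /s' liftK.
Qed.

Lemma convex_comb_leq (R : numDomainType) (V : lmodType R) (A : set V) m p :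
  (m <= p)%N -> convex_comb A m `<=` convex_comb A p.
Proof.
move/subnK <-; elim: (p - m)%N => [//|k IH] v /IH.
exact: convex_comb_grow.
Qed.

Lemma convex_comb_conv (R : numDomainType) (V : lmodType R) (A : set V) m p
    (t : R) (u v : V) : 0 <= t <= 1 -> convex_comb A m u -> convex_comb A p v ->
  convex_comb A (m + p) (t *: u + (1 - t) *: v).
Proof.
move=> /andP[t0 t1] [l [s [l0 l1 sA ->]]] [l' [s' [l'0 l'1 s'A ->]]].
exists (fun i => match fintype.split i with
                 | inl j => t * l j
                 | inr j => (1 - t) * l' j
                 end).
exists (fun i => match fintype.split i with inl j => s j | inr j => s' j end).
split.
- by move=> i; case: (fintype.split i) => j; rewrite mulr_ge0 ?subr_ge0.
- rewrite big_split_ord /=.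
  under eq_bigr do rewrite (unsplitK (inl _)).
  under [X in _ + X]eq_bigr do rewrite (unsplitK (inr _)).
  by rewrite -!mulr_sumr l1 l'1 !mulr1 addrC subrK.
- by move=> i; case: (fintype.split i).
- rewrite [RHS]big_split_ord /= !scaler_sumr.
  congr (_ + _); apply: eq_bigr => i _.
    by rewrite (unsplitK (inl _)) scalerA.
  by rewrite (unsplitK (inr _)) scalerA.
Qed.

(** Each point becomes a row of length [d + 1] by appending an entry 1. More than [d + 1] such rows
    are linearly dependent, and the appended column says that the coefficients sum to 0. *)
Lemma affine_dependence (R : fieldType) d m (s : 'I_m -> 'rV[R]_d) :
  (d.+1 < m)%N -> exists u : 'I_m -> R,
  [/\ exists i, u i != 0, \sum_i u i = 0 & \sum_i u i *: s i = 0].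
Proof.
move=> dm; pose B : 'M[R]_(m, d + 1) := \matrix_i row_mx (s i) (const_mx 1).
have : kermx B != 0.
  rewrite kermx_eq0; apply/negP => /eqP rB.
  by move: (rank_leq_col B); rewrite rB leqNgt addn1 dm.
case/rowV0Pn => u /sub_kermxP uB u0.
have {}uB : row_mx (\sum_i u 0 i *: s i) (const_mx (\sum_i u 0 i))
    = 0 :> 'rV_(d + 1).
  rewrite -uB mulmx_sum_row; apply/rowP => j; rewrite summxE.
  under [RHS]eq_bigr do rewrite rowK mxE.
  rewrite -(splitK j); case: (fintype.split j) => k /=.
    rewrite row_mxEl summxE; apply: eq_bigr => i _.
    by rewrite row_mxEl mxE.
  rewrite row_mxEr mxE; apply: eq_bigr => i _.
  by rewrite row_mxEr mxE mulr1.
exists (u 0); split.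
- have /rV0Pn[i ui] := u0; by exists i.
- move/(congr1 rsubmx): uB; rewrite row_mxKr => /rowP/(_ 0).
  by rewrite !mxE.
- move/(congr1 lsubmx): uB; rewrite row_mxKl => ->.
  by apply/rowP => j; rewrite !mxE.
Qed.

(** A multiple of an affine dependence is subtracted from the weights so that one of them vanishes;
    this changes neither their sum nor the combination. *)
Lemma convex_comb_shrink (R : realFieldType) d m (A : set 'rV[R]_d) :
  (d < m)%N -> convex_comb A m.+1 `<=` convex_comb A m.
Proof.
move=> dm v [l [s [l0 l1 sA ->]]].
have [u [[i1 ui1] u0 us0]] := @affine_dependence R d m.+1 s dm.
have [i0 ui0] : exists i, 0 < u i.
  apply/not_existsP => uneg.
  suff : u i1 = 0 by apply/eqP.
  have /eqP : \sum_i - u i = 0 by rewrite sumrN u0 oppr0.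
  rewrite psumr_eq0; last by move=> i _; rewrite oppr_ge0 leNgt; apply/negP.
  by move=> /allP/(_ i1); rewrite mem_index_enum oppr_eq0 => /(_ isT)/eqP.
(* The least ratio over the positive [u i] is the largest multiple of [u] that leaves all weights
   nonnegative; the weight of index [k] becomes 0. *)
case: (@Order.TotalTheory.arg_minP _ _ _ i0 (fun i => 0 < u i)
  (fun i => l i / u i) ui0) => k uk kmin.
pose c := l k / u k.
pose l' i := l i - c * u i.
have l'k : l' k = 0 by rewrite /l' /c divfK ?subrr// gt_eqF.
have c0 : 0 <= c by rewrite divr_ge0 ?(ltW uk).
have l'0 i : 0 <= l' i.
  rewrite /l' subr_ge0; have [ui|ui] := ltP 0 (u i).
    by rewrite -ler_pdivlMr//; exact: kmin.
  by apply: le_trans (l0 i); rewrite mulr_ge0_le0.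
have l'1 : \sum_i l' i = 1.
  by rewrite big_split /= sumrN -mulr_sumr u0 mulr0 subr0.
have l's : \sum_i l i *: s i = \sum_i l' i *: s i.
  rewrite /l'; under [RHS]eq_bigr do rewrite scalerBl -scalerA.
  by rewrite sumrB -scaler_sumr us0 scaler0 subr0.
exists (fun i => l' (lift k i)), (fun i => s (lift k i)); split => //.
- by rewrite -l'1 [RHS](bigD1_ord k)//= l'k add0r.
- by rewrite l's (bigD1_ord k)//= l'k scale0r add0r.
Qed.

Lemma caratheodory (R : realFieldType) d m (A : set 'rV[R]_d) :
  convex_comb A m `<=` convex_comb A d.+1.
Proof.
elim: m => [|m IH]; first exact: convex_comb_leq.
have [md|dm] := leqP m d; first exact: convex_comb_leq.
by move=> v /(convex_comb_shrink dm)/IH.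
Qed.

Lemma fmap_ultra (T U : Type) (f : T -> U) (F : set_system T) :
  UltraFilter F -> UltraFilter (f @ F).
Proof.
move=> FU; constructor; first exact: fmap_proper_filter.
move=> G GF FG; apply/seteqP; split => // B GB.
have [//|FnB] := in_ultra_setVsetC (f @^-1` B) FU.
have /(filterI GB) : G (~` B) by exact: FG.
by rewrite setICr => /filter_not_empty.
Qed.

(** Along one ultrafilter all bounded quantities converge at once; this replaces the repeated
    extraction of subsequences. *)
Lemma ultra_compact_cvg (T : Type) (V : topologicalType) (F : set_system T)
    (f : T -> V) (A : set V) : UltraFilter F -> compact A ->
  (\forall t \near F, A (f t)) -> exists l : V, f @ F --> l.
Proof.
move=> FU + FA; rewrite compact_ultra => /(_ _ (fmap_ultra f FU) FA).
by move=> [l [_ fl]]; exists l.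
Qed.

Lemma ultra_bounded_cvg (R : realType) (T : Type) (F : set_system T)
    (f : T -> R) (a b : R) : UltraFilter F ->
  (\forall t \near F, a <= f t <= b) -> exists l : R, f @ F --> l.
Proof.
move=> FU Fab; apply: (ultra_compact_cvg FU (@segment_compact _ a b)).
by apply: filterS Fab => t; rewrite /= in_itv.
Qed.

Definition orthant (R : numDomainType) (d : nat) : set 'rV[R]_d :=
  [set v | forall i, 0 <= v 0 i].
Arguments orthant {R d}.

(* Of the d + 1 points of a convex combination, those that stay bounded along an
   ultrafilter converge in A; the others have weights tending to 0, and what
   they contribute in the limit is nonnegative: the orthant absorbs it. *)
Lemma closed_convex_comb_orthant (R : realType) d (A : set 'rV[R]_d) :
  closed A -> A `<=` orthant ->
  closed (minkowski_sum (convex_comb A d.+1) orthant).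
Proof.
move=> Acl A0; set K := minkowski_sum _ _ => p.
rewrite closureEcvg => -[G GP [Gp GK]].
have [F [FU GF]] := ultraFilterLemma GP.
have {}GK : F K by apply/GF/GK.
have Fp j : (fun v : 'rV[R]_d => v 0 j) @ F --> p 0 j.
  by move=> B /(@coord_continuous R 1 d 0 j p B) /Gp /GF.
move=> {G GP Gp GF}.
(* Outside [K] the chosen value is a dummy, harmless because [K] belongs to [F]. The orthant part is
   kept only as an inequality between coordinates. *)
have /choice[q qP] (v : 'rV[R]_d) :
    exists q : ('I_d.+1 -> R) * ('I_d.+1 -> 'rV[R]_d), K v ->
    [/\ forall i, 0 <= q.1 i, \sum_i q.1 i = 1, forall i, A (q.2 i) &
        forall j, \sum_i q.1 i * q.2 i 0 j <= v 0 j].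
  have [|nKv] := pselect (K v); last by exists (fun=> 0, fun=> 0).
  move=> [u [l [s [l0 l1 sA ->]]] [c c0 <-]]; exists (l, s) => _; split => // j.
  rewrite mxE summxE; under [X in _ <= X + _]eq_bigr do rewrite mxE.
  by rewrite lerDl.
pose l v := (q v).1; pose s v := (q v).2.
have {}qP : \forall v \near F, [/\ forall i, 0 <= l v i, \sum_i l v i = 1,
    forall i, A (s v i) & forall j, \sum_i l v i * s v i 0 j <= v 0 j].
  by apply: filterS GK => v /qP.
have [v0 [_ _ /(_ ord0)]] := filter_ex qP.
set a0 := s v0 ord0 => Aa0.
(* [B] exceeds every coordinate of [p], hence eventually bounds those of [v]. As points of [A] are
   nonnegative, it then bounds each single term [l v i * s v i 0 j] too. *)
pose B : R := 1 + \sum_j `|p 0 j|.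
have B0 : 0 < B by rewrite ltr_wpDr// sumr_ge0.
have FB : \forall v \near F, forall j, (v : 'rV[R]_d) 0 j <= B.
  apply: filter_forall => j; near=> v; apply/ltW; near: v.
  apply: (cvgr_lt _ (Fp j)).
  rewrite /B (bigD1 j)//= addrCA.
  apply: (le_lt_trans (ler_norm _)); rewrite ltrDl ltr_wpDr//.
  by rewrite sumr_ge0.
have FT : \forall v \near F, forall i j, 0 <= l v i * s v i 0 j <= B.
  apply: filterS2 qP FB => v [l0 _ sA lv] vB i j.
  have ls0 k : 0 <= l v k * s v k 0 j by rewrite mulr_ge0//; exact/A0/sA.
  rewrite ls0 (le_trans _ (vB j))// (le_trans _ (lv j))//.
  by rewrite (bigD1 i)//= lerDl sumr_ge0.
have Fl01 : \forall v \near F, forall i, 0 <= l v i <= 1.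
  apply: filterS qP => v [l0 l1 _ _] i; rewrite l0 -l1 /=.
  by rewrite (bigD1 i)//= lerDl sumr_ge0.
have /choice[L lL] i : exists L : R, l ^~ i @ F --> L.
  by apply: (@ultra_bounded_cvg _ _ F _ 0 1); apply: filterS Fl01 => v.
have /choice[T1 lT] (ij : 'I_d.+1 * 'I_d) :
    exists t : R, (fun v => l v ij.1 * s v ij.1 0 ij.2) @ F --> t.
  by apply: (@ultra_bounded_cvg _ _ F _ 0 B); apply: filterS FT => v.
have L0 i : 0 <= L i.
  by apply: (cvgr_to_ge (lL i)); apply: filterS Fl01 => v /(_ i)/andP[].
have L1 : \sum_i L i = 1.
  have Fl1 : (fun v => \sum_i l v i) @ F --> (1 : R).
    by apply: cvg_near_cst; apply: filterS qP => v [].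
  suff FlL : (fun v => \sum_i l v i) @ F --> \sum_i L i.
    exact: (@cvg_unique _ (@Rhausdorff R) _ _ _ _ FlL Fl1).
  by apply: cvg_big => //; exact: add_continuous.
have T0 i j : 0 <= T1 (i, j).
  by apply: (cvgr_to_ge (lT (i, j))); apply: filterS FT => v /(_ i j)/andP[].
have [a [aA aT]] : exists a : 'I_d.+1 -> 'rV[R]_d,
    (forall i, A (a i)) /\ forall i j, L i * a i 0 j <= T1 (i, j).
  suff /choice[a aP] i : exists a, A a /\ forall j, L i * a 0 j <= T1 (i, j).
    by exists a; split => i; have [] := aP i.
  have [[M sM]|sM] := pselect (exists M : R, \forall v \near F,
      forall j, s v i 0 j <= M).
    have [] := @ultra_compact_cvg _ _ F (s ^~ i)
       [set v : 'rV[R]_d | forall j, (`[0, M]%classic : set R) (v ord0 j)] FU.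
    - apply: (@rV_compact R d (fun=> `[0, M]%classic)) => _.
      exact: segment_compact.
    - apply: filterS2 qP sM => v [_ _ sA _] vM j.
      by rewrite /= in_itv /= vM andbT; apply/A0/sA.
    move=> a sa; exists a; split.
      by apply: (closed_cvg _ Acl _ _ sa); apply: filterS qP => v [].
    move=> j; rewrite le_eqVlt; apply/orP; left; apply/eqP.
    suff lsT : (fun v => l v i * s v i 0 j) @ F --> L i * a 0 j.
      exact: (@cvg_unique _ (@Rhausdorff R) _ _ _ _ lsT (lT (i, j))).
    apply: (@cvgM _ _ F _ _ _ _ _ (lL i)).
    by move=> U /(@coord_continuous R 1 d 0 j a U) /sa.
  (* A point that does not stay bounded is replaced by the arbitrary [a0], its limit weight being 0:
     if [L i > 0], then eventually [l v i > L i / 2], and the bound [B] on the terms gives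
     [s v i 0 k <= 2 * B / L i]. *)
  exists a0; split => // j; suff -> : L i = 0 by rewrite mul0r.
  apply/eqP; rewrite eq_le L0 andbT leNgt; apply/negP => Li.
  apply: sM; exists (2 * B / L i).
  have FlL : \forall v \near F, L i / 2 < l v i.
    by apply: (cvgr_gt _ (lL i)); rewrite ltr_pdivrMr// ltr_pMr// ltr1n.
  apply: filterS2 FlL FT => v lv /(_ i) Tv k.
  have lv0 : 0 < l v i by apply: lt_trans lv; rewrite divr_gt0.
  have /andP[ls0 lsB] := Tv k.
  have s0 : 0 <= s v i 0 k by rewrite -(pmulr_rge0 _ lv0).
  rewrite ler_pdivlMr//.
  have := ler_wpM2r s0 (ltW lv).
  by move: ls0 lsB; lra.
exists (\sum_i L i *: a i); first by exists L, a.
exists (p - \sum_i L i *: a i); last by rewrite addrC subrK.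
move=> j; rewrite !mxE summxE subr_ge0.
apply: (@le_trans _ _ (\sum_i T1 (i, j))).
  by apply: ler_sum => i _; rewrite mxE.
have lT' : (fun v => \sum_i l v i * s v i 0 j) @ F --> \sum_i T1 (i, j).
  by apply: cvg_big => // [|i _]; [exact: add_continuous|exact: (lT (i, j))].
by apply: (ler_cvg_to lT' (Fp j)); apply: filterS qP => v [].
Unshelve. all: by end_near. Qed.

(** * Separation from a closed convex set *)

Definition dotr (R : pzRingType) d (u v : 'rV[R]_d) : R := \sum_i u 0 i * v 0 i.

Lemma dotrDr (R : pzRingType) d (u v w : 'rV[R]_d) :
  dotr u (v + w) = dotr u v + dotr u w.
Proof. by rewrite -big_split; apply: eq_bigr => i _; rewrite mxE mulrDr. Qed.

Lemma dotrZr (R : comPzRingType) d (a : R) (u v : 'rV[R]_d) :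
  dotr u (a *: v) = a * dotr u v.
Proof. by rewrite mulr_sumr; apply: eq_bigr => i _; rewrite mxE mulrCA. Qed.

Lemma dotrBr (R : comPzRingType) d (u v w : 'rV[R]_d) :
  dotr u (v - w) = dotr u v - dotr u w.
Proof. by rewrite dotrDr -scaleN1r dotrZr mulN1r. Qed.

Lemma dotrC (R : comPzRingType) d (u v : 'rV[R]_d) : dotr u v = dotr v u.
Proof. by apply: eq_bigr => i _; rewrite mulrC. Qed.

Lemma dotr_sqrDZ (R : comPzRingType) d (t : R) (u v : 'rV[R]_d) :
  dotr (u + t *: v) (u + t *: v)
  = dotr u u + 2 * t * dotr u v + t ^+ 2 * dotr v v.
Proof.
rewrite dotrDr dotrZr ![dotr (u + _) _]dotrC !dotrDr !dotrZr (dotrC v u).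
ring.
Qed.

Lemma dotr_continuous (R : realType) d (u : 'rV[R]_d) : continuous (dotr u).
Proof.
apply: continuous_big => [|i _ v]; first exact: add_continuous.
apply: continuousM; first exact: cst_continuous.
exact: (@coord_continuous R 1 d 0 i v).
Qed.

Lemma dotr_self_continuous (R : realType) d :
  continuous (fun v : 'rV[R]_d => dotr v v).
Proof.
apply: continuous_big => [|i _ v]; first exact: add_continuous.
by apply: continuousM; exact: (@coord_continuous R 1 d 0 i v).
Qed.

Lemma dotr_self_ge0 (R : realDomainType) d (v : 'rV[R]_d) : 0 <= dotr v v.
Proof. by rewrite sumr_ge0// => i _; rewrite -expr2 sqr_ge0. Qed.

Lemma dotr_self_eq0 (R : realDomainType) d (v : 'rV[R]_d) :
  dotr v v = 0 -> v = 0.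
Proof.
move/eqP; rewrite psumr_eq0 => [/allP v0|i _]; last by rewrite -expr2 sqr_ge0.
apply/rowP => i; rewrite mxE; apply/eqP.
by have := v0 i; rewrite mem_index_enum -expr2 sqrf_eq0; apply.
Qed.

(** The points of [K] at most as far from [x] as some [k0] form a compact set, on which the squared
    distance attains its minimum. *)
Lemma closed_nearest_point (R : realType) d (K : set 'rV[R]_d) (x : 'rV[R]_d) :
  closed K -> K !=set0 -> exists2 p, K p &
  forall k, K k -> dotr (p - x) (p - x) <= dotr (k - x) (k - x).
Proof.
move=> Kcl [k0 Kk0]; pose D (k : 'rV[R]_d) := dotr (k - x) (k - x).
have Dcont : continuous D.
  move=> k; apply: (@continuous_comp _ _ _ (fun k : 'rV[R]_d => k - x)
    (fun v : 'rV[R]_d => dotr v v)).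
    by apply: continuousB; [exact: cvg_id|exact: cst_continuous].
  exact: dotr_self_continuous.
(* This radius avoids a square root: [t ^+ 2 <= D k0] implies [|t| <= 1 + D k0]. *)
pose r := 1 + D k0.
pose box := [set v : 'rV[R]_d |
  forall i, (`[x 0 i - r, x 0 i + r]%classic : set R) (v ord0 i)].
pose C := K `&` [set k | D k <= D k0].
have Ccpt : compact C.
  apply: (@subclosed_compact _ _ box).
  - apply: closedI => //.
    exact: ((continuous_closedP D).1 Dcont _ (@closed_le R (D k0))).
  - apply: (@rV_compact R d (fun i => `[x 0 i - r, x 0 i + r]%classic)) => i.
    exact: segment_compact.
  - move=> k [_ /= Dk] i; rewrite /= in_itv /=.
    have ki : (k 0 i - x 0 i) ^+ 2 <= D k0.
      apply: le_trans Dk; rewrite /D /dotr (bigD1 i)//= !mxE -expr2 lerDl.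
      by rewrite sumr_ge0// => j _; rewrite -expr2 sqr_ge0.
    rewrite -[k ord0 i]/(k 0 i) -ler_distl.
    rewrite -ler_sqr ?nnegrE ?addr_ge0 ?dotr_self_ge0//.
    rewrite real_normK ?num_real// (le_trans ki)// sqrrD expr1n mul1r.
    rewrite addrAC ler_wpDl// ?addr_ge0 ?sqr_ge0//.
    by rewrite mulr2n lerDl dotr_self_ge0.
have [|||p] := @compact_EVT_min _ R D C => //.
- by exists k0; split => /=.
- exact: continuous_subspaceT.
rewrite inE => -[Kp Dp] pmin; exists p => // k Kk.
have [kC|kC] := leP (D k) (D k0); first by apply: pmin; rewrite inE.
exact: le_trans Dp (ltW kC).
Qed.

(** The normal is [w = p - x], with [p] the point of [K] nearest to [x]. If some [k] in [K] had
    [dotr w (k - p) < 0], a small move from [p] towards [k] would come nearer to [x]. *)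
Lemma closed_convex_separation (R : realType) d (K : set 'rV[R]_d)
    (x : 'rV[R]_d) :
  closed K -> K !=set0 ->
  (forall u v t, K u -> K v -> 0 <= t <= 1 -> K (t *: u + (1 - t) *: v)) ->
  ~ K x -> exists (w : 'rV[R]_d) (a : R),
    dotr w x < a /\ forall k, K k -> a <= dotr w k.
Proof.
move=> Kcl K0 Kconv Kx; have [p Kp pmin] := closed_nearest_point x Kcl K0.
pose w := p - x; exists w, (dotr w p).
have ww : 0 < dotr w w.
  rewrite lt_neqAle dotr_self_ge0 andbT; apply/eqP => /esym/dotr_self_eq0/eqP.
  by rewrite subr_eq0 => /eqP px; apply: Kx; rewrite -px.
split.
  rewrite -subr_gt0; suff -> : dotr w p - dotr w x = dotr w w by [].
  by rewrite -dotrBr.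
move=> k Kk; rewrite -subr_ge0 leNgt; apply/negP => kneg.
pose q := dotr (k - p) (k - p); pose a := dotr w (k - p).
have a0 : a < 0 by rewrite /a dotrBr.
have q0 : 0 <= q by exact: dotr_self_ge0.
have tD t : 0 <= t <= 1 -> 0 <= 2 * t * a + t ^+ 2 * q.
  move=> t01; have := pmin _ (Kconv _ _ _ Kk Kp t01).
  have -> : t *: k + (1 - t) *: p - x = w + t *: (k - p).
    by apply/rowP => i; rewrite !mxE; ring.
  by rewrite -/w dotr_sqrDZ -/a -/q -addrA lerDl.
(* For this [t], [t * q <= - a], so [2 * t * a + t ^+ 2 * q <= t * a < 0], against [tD]. *)
pose t := - a / (- a + q).
have aq : 0 < - a + q by rewrite ltr_pwDl ?oppr_gt0.
have t0 : 0 < t by rewrite divr_gt0 ?oppr_gt0.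
have t1 : t <= 1 by rewrite ler_pdivrMr// mul1r lerDl.
have := tD t; rewrite t1 (ltW t0) => /(_ isT).
have tq : t * q <= - a.
  by rewrite /t mulrAC ler_pdivrMr//; nra.
by nra.
Qed.

(** * Finitely supported functions and their linear images *)

Lemma fset_supp (T : choiceType) (R : realType) (s : fsupp T R) :
  exists A : {fset T}, s @^-1` [set~ 0] `<=` [set` A].
Proof. by have /finite_fsetP[A ->] := fsuppP s; exists A. Qed.

Section fslin.
Variables (T : choiceType) (R : realType).
Implicit Types (s t : fsupp T R).

(** The linear extension of [f] to the free vector space on [T], whose basis consists of the
    [fsdelta r]. *)
Definition fslin (V : lmodType R) (f : T -> V) s : V :=
  \sum_(r \in [set: T]) s r *: f r.

Lemma fslinE (V : lmodType R) (f : T -> V) s (A : {fset T}) :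
  s @^-1` [set~ 0] `<=` [set` A] -> fslin f s = \sum_(r <- A) s r *: f r.
Proof.
move=> sA; apply: fsbigTE => r rA.
suff -> : s r = 0 by rewrite scale0r.
by apply: contrapT => sr; move/negP: rA; apply; exact: sA.
Qed.

Lemma fslinP (V : lmodType R) (f : T -> V) : linear (fslin f).
Proof.
move=> a s t; have [A sA] := fset_supp s; have [B tB] := fset_supp t.
have sAB : s @^-1` [set~ 0] `<=` [set` (A `|` B)%fset].
  by move=> r /sA /= rA; rewrite inE rA.
have tAB : t @^-1` [set~ 0] `<=` [set` (A `|` B)%fset].
  by move=> r /tB /= rB; rewrite inE rB orbT.
rewrite !(@fslinE _ _ _ (A `|` B)%fset)//.
  rewrite scaler_sumr -big_split; apply: eq_bigr => r _ /=.
  by rewrite scalerA -scalerDl.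
move=> r /= str; apply: contrapT => rAB; apply: str.
rewrite -[LHS]/(a * s r + t r).
have -> : s r = 0 by apply: contrapT => /sAB.
have -> : t r = 0 by apply: contrapT => /tAB.
by rewrite mulr0 addr0.
Qed.

HB.instance Definition _ (V : lmodType R) (f : T -> V) :=
  GRing.isLinear.Build R (fsupp T R) V *:%R (fslin f) (@fslinP V f).

Lemma delta_fsupp (r : T) : (fun r' => (r' == r)%:R : R) \in @has_fsupp T R.
Proof.
apply/asboolP; apply: (@sub_finite_set _ _ [set r]); last exact: finite_set1.
by move=> r' /=; have [//|_ /(_ erefl)] := eqVneq r' r.
Qed.

Definition fsdelta (r : T) : fsupp T R := FSupp (delta_fsupp r).

Lemma fslin_delta (V : lmodType R) (f : T -> V) r : fslin f (fsdelta r) = f r.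
Proof.
rewrite (@fslinE _ _ _ [fset r]%fset).
  by rewrite big_seq_fset1 /= eqxx scale1r.
by move=> r' /=; rewrite inE; have [//|_ /(_ erefl)] := eqVneq r' r.
Qed.

Lemma fslin_comp (V W : lmodType R) (f : T -> V) (h : {linear V -> W}) s :
  h (fslin f s) = fslin (h \o f) s.
Proof.
have [A sA] := fset_supp s; rewrite !(fslinE _ sA) linear_sum.
by apply: eq_bigr => r _; rewrite linearZ.
Qed.

Lemma fslin0 (V : lmodType R) s : fslin (fun=> 0 : V) s = 0.
Proof.
have [A sA] := fset_supp s; rewrite (fslinE _ sA) big1// => r _.
exact: scaler0.
Qed.

Lemma fslin_eval s x : fslin (fun r => fsdelta r x : R^o) s = s x.
Proof.
have [A sA] := fset_supp s; rewrite (fslinE _ sA).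
have [xA|xA] := boolP (x \in A).
  rewrite (big_fsetD1 x)//= -[LHS]/(s x * (x == x)%:R + _) eqxx mulr1.
  rewrite big_seq big1 ?addr0// => y; rewrite !inE => /andP[yx _].
  by rewrite -[LHS]/(s y * (x == y)%:R) eq_sym (negbTE yx) mulr0.
have -> : s x = 0 by apply: contrapT => /sA; exact/negP.
rewrite big_seq big1// => y yA; rewrite -[LHS]/(s y * (x == y)%:R).
by case: eqVneq yA xA => [-> ->|]; rewrite ?mulr0.
Qed.

Lemma eq_fslin_supp (V : lmodType R) (f g : T -> V) s :
  (forall r, s r <> 0 -> f r = g r) -> fslin f s = fslin g s.
Proof.
move=> fg; have [A sA] := fset_supp s; rewrite !(fslinE _ sA).
apply: eq_bigr => r _; have [->|/eqP/fg->//] := eqVneq (s r) 0.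
by rewrite !scale0r.
Qed.

Lemma fslin_eq0 (V : lmodType R) (f : T -> V) s :
  (forall r, s r <> 0 -> f r = 0) -> fslin f s = 0.
Proof. by move=> f0; rewrite (eq_fslin_supp f0) fslin0. Qed.

Lemma fslin_ge0 (f : T -> R^o) s :
  (forall r, 0 <= f r) -> (forall r, 0 <= s r) -> 0 <= fslin f s.
Proof.
move=> f0 s0; have [A sA] := fset_supp s; rewrite !(fslinE _ sA).
by rewrite sumr_ge0// => r _; rewrite mulr_ge0.
Qed.

Lemma fslin_nat (f : T -> R^o) s :
  (forall r, f r \is a Num.nat) -> (forall r, s r \is a Num.nat) ->
  (fslin f s : R) \is a Num.nat.
Proof.
move=> f0 s0; have [A sA] := fset_supp s; rewrite !(fslinE _ sA).
by rewrite rpred_sum// => r _; rewrite rpredM.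
Qed.

End fslin.

(** * Pairs of finitely supported functions, and the projection onto finitely many directions *)

Section plin.
Variables (R : realType) (n : nat).
Implicit Types (x y : fspair R n).

Definition plin (V : lmodType R) (f g : 'rV[R]_n -> V) x : V :=
  fslin f x.1 + fslin g x.2.

Lemma plinP (V : lmodType R) (f g : 'rV[R]_n -> V) : linear (plin f g).
Proof.
move=> a x y; rewrite /plin.
rewrite -[(a *: x + y).1]/(a *: x.1 + y.1) -[(a *: x + y).2]/(a *: x.2 + y.2).
by rewrite !linearP /= scalerDr addrACA.
Qed.

HB.instance Definition _ (V : lmodType R) (f g : 'rV[R]_n -> V) :=
  GRing.isLinear.Build R (fspair R n) V *:%R (plin f g) (@plinP V f g).

Lemma plin_comp (V W : lmodType R) (f g : 'rV[R]_n -> V)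
    (h : {linear V -> W}) x :
  h (plin f g x) = plin (h \o f) (h \o g) x.
Proof. by rewrite linearD !fslin_comp. Qed.

Definition ray (r : 'rV[R]_n) : fspair R n := (fsdelta R r, 0).
Definition pray (p : 'rV[R]_n) : fspair R n := (0, fsdelta R p).

Lemma plin_ray (V : lmodType R) (f g : 'rV[R]_n -> V) r :
  plin f g (ray r) = f r.
Proof. by rewrite /plin /= fslin_delta linear0 addr0. Qed.

Lemma plin_pray (V : lmodType R) (f g : 'rV[R]_n -> V) r :
  plin f g (pray r) = g r.
Proof. by rewrite /plin /= fslin_delta linear0 add0r. Qed.

Definition coord1 (r : 'rV[R]_n) x : R^o := x.1 r.
Definition coord2 (r : 'rV[R]_n) x : R^o := x.2 r.
Lemma coord1P r : linear (coord1 r). Proof. by []. Qed.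
Lemma coord2P r : linear (coord2 r). Proof. by []. Qed.
HB.instance Definition _ r :=
  GRing.isLinear.Build R (fspair R n) R^o *:%R (coord1 r) (coord1P r).
HB.instance Definition _ r :=
  GRing.isLinear.Build R (fspair R n) R^o *:%R (coord2 r) (coord2P r).

Lemma fspair_ext x y : (forall r, coord1 r x = coord1 r y) ->
  (forall r, coord2 r x = coord2 r y) -> x = y.
Proof.
case: x y => [x1 x2] [y1 y2] /= e1 e2.
have -> : x1 = y1 by apply/val_inj/funext.
by have -> : x2 = y2 by apply/val_inj/funext.
Qed.

(** Together with [plin_comp], this turns any linear functional into the [plin] of its values on the
    rays, the form that half-spaces and norm bounds require. *)
Lemma plin_rays x : plin ray pray x = x.
Proof.
apply: fspair_ext => r; rewrite plin_comp /plin.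
  by rewrite -[X in _ + X]/(fslin (fun=> 0 : R^o) x.2) fslin0 addr0 fslin_eval.
by rewrite -[X in X + _]/(fslin (fun=> 0 : R^o) x.1) fslin0 add0r fslin_eval.
Qed.

Lemma eq_plin_supp (V : lmodType R) (f g f' g' : 'rV[R]_n -> V) x :
  (forall r, x.1 r <> 0 -> f r = f' r) ->
  (forall r, x.2 r <> 0 -> g r = g' r) ->
  plin f g x = plin f' g' x.
Proof. by move=> ff' gg'; congr (_ + _); apply: eq_fslin_supp. Qed.

Lemma halfspaceE (psi pi : 'rV[R]_n -> R) (a : R) x :
  halfspace psi pi a x = (a <= plin (psi : _ -> R^o) (pi : _ -> R^o) x).
Proof.
rewrite /halfspace /plin /fslin /=; congr (is_true (_ <= _ + _)).
  by apply: eq_fsbigr => r _; rewrite mulrC.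
by apply: eq_fsbigr => r _; rewrite mulrC.
Qed.

Definition ray_sum : fspair R n -> 'rV[R]_n := plin id id.

HB.instance Definition _ := GRing.Linear.on ray_sum.

(** Phrased through the linear maps [coord1], [coord2] and [ray_sum], membership can be followed
    through [axproj] and through finite-dimensional coordinates. *)
Lemma MbE b x : Mb b x <-> [/\ forall r, 0 <= coord1 r x,
  forall p, (coord2 p x : R) \is a Num.nat & Zn (ray_sum x - b)].
Proof.
split => [[x1 x2 [z zZ xz]]|[x1 x2 xz]]; split => //.
  by rewrite /ray_sum /plin /fslin xz addrAC subrr add0r.
by exists (ray_sum x - b) => //; rewrite [RHS]addrC subrK.
Qed.

(** The sign of the coordinate goes into the direction, so that [axray] has nonnegative
    coefficients. *)
Definition axis (r : 'rV[R]_n) (i : 'I_n) : 'rV[R]_n :=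
  if 0 <= r 0 i then delta_mx 0 i else - delta_mx 0 i.

Definition axray (r : 'rV[R]_n) : fspair R n :=
  \sum_i `|r 0 i| *: ray (axis r i).

Lemma ray_sum_axray r : ray_sum (axray r) = r.
Proof.
rewrite linear_sum [RHS]row_sum_delta; apply: eq_bigr => i _.
rewrite linearZ /= /ray_sum plin_ray /axis; case: ifP => [r0|/negbT].
  by rewrite ger0_norm.
by rewrite -ltNge => /ltr0_norm ->; rewrite scalerN scaleNr opprK.
Qed.

(* The map T of the header. *)
Definition axproj (A : {fset 'rV[R]_n}) : fspair R n -> fspair R n :=
  plin (fun r => if r \in A then ray r else axray r)
       (fun p => if p \in A then pray p else axray p).

HB.instance Definition _ A := GRing.Linear.on (axproj A).

Definition supported (A : {fset 'rV[R]_n}) x :=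
  (forall r, x.1 r <> 0 -> r \in A) /\ (forall r, x.2 r <> 0 -> r \in A).

Lemma axproj_id A x : supported A x -> axproj A x = x.
Proof.
move=> [x1 x2]; rewrite -[RHS]plin_rays.
by apply: eq_plin_supp => r; [move/x1 => ->|move/x2 => ->].
Qed.

Lemma ray_sum_axproj A x : ray_sum (axproj A x) = ray_sum x.
Proof.
rewrite plin_comp; apply: eq_plin_supp => r _ /=; case: ifP => _;
  by rewrite ?ray_sum_axray// /ray_sum ?plin_ray ?plin_pray.
Qed.

Lemma coord1_axray_ge0 r p : 0 <= (coord1 r (axray p) : R).
Proof.
rewrite linear_sum sumr_ge0// => i _; rewrite linearZ /= mulr_ge0//.
Qed.

Lemma coord2_axray r p : coord2 r (axray p) = 0.
Proof. by rewrite linear_sum big1// => i _; rewrite linearZ /= scaler0. Qed.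

Lemma coord1_axproj_ge0 A x r :
  nonneg_cone x -> 0 <= (coord1 r (axproj A x) : R).
Proof.
move=> [x1 x2]; rewrite plin_comp addr_ge0// fslin_ge0// => p /=;
  case: ifP => _ //;
  by rewrite ?coord1_axray_ge0 // /coord1 /= ler0n.
Qed.

Lemma Mb_nonneg b x : Mb b x -> nonneg_cone x.
Proof. by move=> [x1 x2 _]; split => // p; rewrite natr_ge0. Qed.

(** The projection keeps an integer ray or turns it into continuous ones, and creates no new integer
    ray. *)
Lemma coord2_axproj_nat A x r :
  (forall p, x.2 p \is a Num.nat) -> (coord2 r (axproj A x) : R) \is a Num.nat.
Proof.
move=> x2; rewrite plin_comp rpredD//.
  rewrite fslin_eq0 ?rpred0// => p _ /=.
  by case: ifP => _; rewrite ?coord2_axray.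
apply: fslin_nat => // p /=; case: ifP => _; rewrite ?coord2_axray ?rpred0//.
by rewrite /coord2 /= rpred_nat.
Qed.

Lemma Mb_axproj A b x : Mb b x -> Mb b (axproj A x).
Proof.
move=> bx; have x0 := Mb_nonneg bx.
move/MbE : bx => [x1 x2 xz]; apply/MbE; split.
- by move=> r; exact: coord1_axproj_ge0.
- by move=> r; exact: coord2_axproj_nat.
- by rewrite ray_sum_axproj.
Qed.

Lemma coord1_axray_notin (A : {fset 'rV[R]_n}) r p :
  (forall r i, axis r i \in A) -> r \notin A -> coord1 r (axray p) = 0.
Proof.
move=> axA rA; rewrite linear_sum big1// => i _; rewrite linearZ /=.
rewrite /coord1 /=; have [ra|_] := eqVneq r (axis p i).
  by move: rA; rewrite ra axA.
exact: scaler0.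
Qed.

(** A direction outside [A] is sent to axis rays, which lie in [A] by hypothesis. *)
Lemma supported_axproj A x :
  (forall r i, axis r i \in A) -> supported A (axproj A x).
Proof.
move=> axA; split => r; apply: contraPP => /negP rA.
  rewrite -[LHS]/(coord1 r (axproj A x)) plin_comp /plin.
  rewrite !fslin_eq0 ?addr0// => p _ /=; case: ifPn => pA;
    rewrite ?(@coord1_axray_notin A)//.
  have [rp|rp] := eqVneq r p; first by move: rA; rewrite rp pA.
  by rewrite /coord1 /= (negbTE rp).
rewrite -[LHS]/(coord2 r (axproj A x)) plin_comp /plin.
rewrite !fslin_eq0 ?addr0// => p _ /=; case: ifPn => pA;
  rewrite ?coord2_axray//.
have [rp|rp] := eqVneq r p; first by move: rA; rewrite rp pA.
by rewrite /coord2 /= (negbTE rp).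
Qed.

Lemma supported_fset (x : fspair R n) : exists A : {fset 'rV[R]_n},
  supported A x /\ forall r i, axis r i \in A.
Proof.
have [A1 xA1] := fset_supp x.1; have [A2 xA2] := fset_supp x.2.
pose B : {fset 'rV[R]_n} := [fset x in
  [seq delta_mx 0 i | i <- enum 'I_n] ++
  [seq - delta_mx 0 i | i <- enum 'I_n]]%fset.
exists (A1 `|` A2 `|` B)%fset; split.
  by split => r; [move/xA1 => /= rA|move/xA2 => /= rA]; rewrite !inE rA ?orbT.
move=> r i; rewrite !inE /axis; apply/orP; right; apply/orP.
by case: ifP => _; [left|right]; apply/mapP; exists i => //; rewrite mem_enum.
Qed.

End plin.

(** * Convex hulls and closures *)

Lemma convex_setE (R : realType) (V : lmodType R) (A : set V) :
  @convex_set R V A <-> forall x y t, 0 <= t <= 1 -> A x -> A y ->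
    A (t *: x + (1 - t) *: y).
Proof.
split => [cA x y t /andP[t0 t1] /mem_set Ax /mem_set Ay|cA x y l].
  by have /set_mem := cA x y (Itv01 t0 t1) Ax Ay.
rewrite !inE => Ax Ay; apply: cA => //.
by apply/andP; split; [exact: ge0|exact: le1].
Qed.

Section convex_hull.
Variables (R : realType) (V : lmodType R).
Implicit Types A B : set V.

Lemma convex_hull_conv A x y t : 0 <= t <= 1 ->
  convex_hull A x -> convex_hull A y -> convex_hull A (t *: x + (1 - t) *: y).
Proof.
move=> t01 Ax Ay B [cB AB].
by apply: (convex_setE B).1 => //; [exact: Ax|exact: Ay].
Qed.

Lemma sub_convex_hull A : A `<=` convex_hull A.
Proof. exact: sub_gen_smallest. Qed.

Lemma convex_hull_sub A B :
  (forall x y t, 0 <= t <= 1 -> B x -> B y -> B (t *: x + (1 - t) *: y)) ->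
  A `<=` B -> convex_hull A `<=` B.
Proof. by move=> /convex_setE cB AB; exact: smallest_sub. Qed.

(** Induction on [m]: the first point is split off and the other weights are divided by their sum
    [q = 1 - t]. *)
Lemma convex_comb_hull A m : convex_comb A m `<=` convex_hull A.
Proof.
elim: m => [|m IH] v [l [s [l0 l1 sA ->]]].
  by move: l1; rewrite big_ord0 => /esym/eqP; rewrite oner_eq0.
rewrite big_ord_recl; move: l1; rewrite big_ord_recl => l1.
set t := l ord0 in l1 *; set q := \sum_(i < m) _ in l1.
have q0 : 0 <= q by rewrite sumr_ge0.
have qE : q = 1 - t by rewrite -l1 addrC addKr.
(* If [q = 0], division is impossible, but all other weights vanish and only the first point
   remains. *)
have [q_eq0|q_neq0] := eqVneq q 0.
  have -> : t = 1 by rewrite -l1 q_eq0 addr0.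
  rewrite scale1r big1 => [|i _].
    by rewrite addr0; exact: (sub_convex_hull (sA _)).
  have /eqP := q_eq0; rewrite psumr_eq0// => /allP/(_ i).
  by rewrite mem_index_enum => /(_ isT)/eqP ->; rewrite scale0r.
have -> : \sum_(i < m) l (lift ord0 i) *: s (lift ord0 i) =
    (1 - t) *: (\sum_(i < m) (l (lift ord0 i) / q) *: s (lift ord0 i)).
  rewrite scaler_sumr; apply: eq_bigr => i _.
  by rewrite scalerA -qE mulrCA divff// mulr1.
apply: convex_hull_conv; first by rewrite /t l0 /= -subr_ge0 -qE.
  exact: (sub_convex_hull (sA _)).
apply: IH; exists (fun i => l (lift ord0 i) / q), (fun i => s (lift ord0 i)).
split => //; first by move=> i; rewrite divr_ge0.
by rewrite -mulr_suml divff.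
Qed.

End convex_hull.

Section closure.
Variables (R : realType) (V : normedModType R).
Implicit Types A B : set V.

Lemma closure_normP A p :
  closure A p <-> forall e, 0 < e -> exists2 a, A a & `|p - a| < e.
Proof.
split=> [Ap e e0|Ap B /nbhs_normP[e /= e0 eB]].
  have /Ap[a [Aa pa]] : nbhs p (ball p e) by exact: nbhsx_ballx.
  by exists a => //; move: pa; rewrite -ball_normE.
have [a Aa pa] := Ap e e0; exists a; split => //; exact: eB.
Qed.

Lemma closure_conv A :
  (forall x y t, 0 <= t <= 1 -> A x -> A y -> A (t *: x + (1 - t) *: y)) ->
  forall x y t, 0 <= t <= 1 -> closure A x -> closure A y ->
    closure A (t *: x + (1 - t) *: y).
Proof.
move=> cA x y t t01 /closure_normP Ax /closure_normP Ay.
apply/closure_normP => e e0.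
have [a Aa xa] := Ax e e0; have [b Ab yb] := Ay e e0.
exists (t *: a + (1 - t) *: b); first exact: cA.
have -> : t *: x + (1 - t) *: y - (t *: a + (1 - t) *: b) =
    t *: (x - a) + (1 - t) *: (y - b) by rewrite !scalerBr opprD addrACA.
apply: le_lt_trans (ler_normD _ _) _; rewrite !normrZ.
move: t01 => /andP[t0 t1].
rewrite ger0_norm// ger0_norm ?subr_ge0//.
have : Num.max `|x - a| `|y - b| < e by rewrite gt_max xa yb.
apply: le_lt_trans; set M := Num.max _ _.
have -> : M = t * M + (1 - t) * M by ring.
by rewrite lerD// ler_wpM2l ?subr_ge0// le_max lexx ?orbT.
Qed.

(** A translation needs to be tested only on [A], and even there it may land in the closure. *)
Lemma closure_translate A c :
  (forall x, A x -> closure A (x + c)) ->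
  forall x, closure A x -> closure A (x + c).
Proof.
move=> Ac x /closure_normP Ax; apply/closure_normP => e e0.
have e20 : 0 < e / 2 by rewrite divr_gt0.
have [a Aa xa] := Ax _ e20.
have /closure_normP/(_ _ e20)[b Ab ab] := Ac a Aa.
exists b => //; rewrite (splitr e).
have -> : x + c - b = (x - a) + (a + c - b) by rewrite -!addrA addKr.
exact: le_lt_trans (ler_normD _ _) (ltrD xa ab).
Qed.

End closure.

(** * Functionals that are bounded for the star norm *)

Section halfspace_closure.
Variables (R : realType) (n : nat).
Implicit Types (x : fspair R n) (b : 'rV[R]_n).

Lemma fspair_normE x : `|x| = fsnorm x.1 + fsnorm x.2.
Proof. by rewrite -star_normE. Qed.

(** The norm of the basis vector at [r]: the star norm is the weighted l1 norm with these weights,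
    and the indicator accounts for the separate term at 0. *)
Definition weight (r : 'rV[R]_n) : R := (r == 0)%:R + enorm r.

Lemma enorm_ge0 (r : 'rV[R]_n) : 0 <= enorm r.
Proof. exact: sqrtr_ge0. Qed.

Lemma weight_gt0 r : 0 < weight r.
Proof.
rewrite /weight; have [_|r0] := eqVneq r 0.
  by rewrite ltr_pwDl ?enorm_ge0.
rewrite add0r lt_neqAle enorm_ge0 andbT; apply/eqP => /esym/enorm_eq0/eqP.
by rewrite (negbTE r0).
Qed.

Lemma fsnorm_weight (s : fsupp 'rV[R]_n R) (A : {fset 'rV[R]_n}) :
  s @^-1` [set~ 0] `<=` [set` A] -> fsnorm s = \sum_(r <- A) weight r * `|s r|.
Proof.
move=> sA; rewrite (fsnormE sA).
under [RHS]eq_bigr do rewrite mulrDl.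
rewrite big_split /=; congr (_ + _).
have [A0|A0] := boolP (0 \in A).
  rewrite (big_fsetD1 0)//= eqxx mul1r big_seq big1 ?addr0// => r.
  by rewrite !inE => /andP[/negbTE -> _]; rewrite mul0r.
have -> : s 0 = 0 by apply: contrapT => /sA; exact/negP.
rewrite normr0 big_seq big1// => r rA; have [r0|_] := eqVneq r 0.
  by move: A0; rewrite -r0 rA.
by rewrite mul0r.
Qed.

Lemma fsnorm_fsdelta r : fsnorm (fsdelta R r) = weight r.
Proof.
rewrite (@fsnorm_weight _ [fset r]%fset).
  by rewrite big_seq_fset1 /= eqxx normr1 mulr1.
by move=> r' /=; rewrite inE; have [//|_ /(_ erefl)] := eqVneq r' r.
Qed.

Lemma fsnorm0 : fsnorm (0 : fsupp 'rV[R]_n R) = 0.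
Proof.
by rewrite (@fsnorm_weight _ fset0) ?big_seq_fset0// => r /= /(_ erefl).
Qed.

Lemma norm_ray r : `|ray r| = weight r.
Proof. by rewrite fspair_normE fsnorm_fsdelta fsnorm0 addr0. Qed.

Lemma fslin_bounded (f : 'rV[R]_n -> R^o) (C : R) (s : fsupp 'rV[R]_n R) :
  (forall r, `|f r : R| <= C * weight r) -> `|fslin f s : R| <= C * fsnorm s.
Proof.
move=> fC; have [A sA] := fset_supp s.
rewrite (fslinE _ sA) (fsnorm_weight sA) mulr_sumr.
apply: le_trans (ler_norm_sum _ _ _) _; apply: ler_sum => r _.
by rewrite normrM mulrC mulrA ler_wpM2r.
Qed.

Lemma plin_bounded (f g : 'rV[R]_n -> R^o) (C : R) x :
  (forall r, `|f r : R| <= C * weight r) ->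
  (forall r, `|g r : R| <= C * weight r) ->
  `|plin f g x : R| <= C * `|x|.
Proof.
move=> fC gC; rewrite fspair_normE mulrDr.
by apply: le_trans (ler_normD _ _) (lerD _ _); exact: fslin_bounded.
Qed.

(** The inequality passes to the convex hull by linearity, and to the closure because a functional
    bounded on the basis vectors is Lipschitz. *)
Lemma closure_hull_ge b (f g : 'rV[R]_n -> R^o) (C a : R) :
  (forall r, `|f r : R| <= C * weight r) ->
  (forall r, `|g r : R| <= C * weight r) ->
  (forall x, Mb b x -> a <= plin f g x) ->
  forall x, closure (convex_hull (Mb b)) x -> a <= plin f g x.
Proof.
move=> fC gC aM x /closure_normP xcl; rewrite leNgt; apply/negP => xa.
have C0 : 0 <= C.
  by rewrite -(pmulr_lge0 _ (weight_gt0 0)) (le_trans _ (fC 0)).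
have C1 : 0 < C + 1 by rewrite ltr_wpDl.
(* Dividing by [C + 1] rather than [C] covers the case [C = 0]. *)
have e0 : 0 < (a - plin f g x) / (C + 1) by rewrite divr_gt0// subr_gt0.
have [y hy xy] := xcl _ e0.
have ay : a <= plin f g y.
  move: y hy {xy}; apply: (convex_hull_sub _ aM) => u v t /andP[t0 t1] au av.
  rewrite linearD !linearZ /=.
  have -> : a = t * a + (1 - t) * a by ring.
  by rewrite lerD// ler_wpM2l ?subr_ge0.
have := plin_bounded (x - y) fC gC; rewrite linearB => /= fxy.
have : `|x - y| * (C + 1) < a - plin f g x by rewrite -ltr_pdivlMr.
have := ler_norm (plin f g y - plin f g x); rewrite distrC.
have := normr_ge0 (x - y).
move: fxy ay; set u : R := plin f g x; set v : R := plin f g y.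
by set w := `|x - y|; set z := `|_|; lra.
Qed.

End halfspace_closure.

(** * The chain of inclusions *)

Section inclusions.
Variables (R : realType) (n : nat).
Implicit Types (x : fspair R n) (b : 'rV[R]_n).

Lemma coord_le_enorm (r : 'rV[R]_n) i : `|r 0 i| <= enorm r.
Proof.
rewrite -sqrtr_sqr; apply: ler_wsqrtr; rewrite (bigD1 i)//= lerDl.
by rewrite sumr_ge0// => j _; exact: sqr_ge0.
Qed.

Lemma finite_bounded (A : {fset 'rV[R]_n}) (f : 'rV[R]_n -> R^o) :
  exists2 C, 0 <= C & forall r, r \in A -> `|f r : R| <= C * weight r.
Proof.
have w0 r : 0 <= `|f r : R| / weight r by rewrite divr_ge0// ltW// weight_gt0.
exists (\sum_(r <- A) `|f r : R| / weight r); first by rewrite sumr_ge0.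
move=> r rA; rewrite -ler_pdivrMr ?weight_gt0//.
by rewrite (big_fsetD1 r)//= lerDl sumr_ge0.
Qed.

(** On axis decompositions [h] is determined by its values at the [2n] axis rays, and each
    coefficient satisfies [|r_i| <= enorm r <= weight r]. *)
Lemma axray_bounded (h : {linear fspair R n -> R^o}) :
  exists2 C, 0 <= C & forall r, `|h (axray r) : R| <= C * weight r.
Proof.
pose M i : R := `|h (ray (delta_mx 0 i)) : R| + `|h (ray (- delta_mx 0 i)) : R|.
have M0 i : 0 <= M i by rewrite addr_ge0.
exists (\sum_i M i) => [|r]; first by rewrite sumr_ge0.
rewrite linear_sum mulr_suml.
apply: le_trans (ler_norm_sum _ _ _) (ler_sum _ _) => i _.
rewrite linearZ normrM normr_id mulrC; apply: ler_pM => //.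
  by rewrite /M /axis; case: ifP => _; rewrite ?lerDl ?lerDr.
by rewrite (le_trans (coord_le_enorm r i))// lerDr.
Qed.

Lemma axproj_bounded (h : {linear fspair R n -> R^o}) (A : {fset 'rV[R]_n}) :
  exists C,
  (forall r, `|h (if r \in A then ray r else axray r) : R| <= C * weight r) /\
  (forall r, `|h (if r \in A then pray r else axray r) : R| <= C * weight r).
Proof.
have [C1 C10 hC1] := finite_bounded A (h \o @ray R n).
have [C2 C20 hC2] := finite_bounded A (h \o @pray R n).
have [C3 C30 hC3] := axray_bounded h.
exists (C1 + C2 + C3); split => r; have w0 := ltW (weight_gt0 r).
  case: ifP => [/hC1 /le_trans|_]; [apply|apply: le_trans (hC3 r) _];
    by rewrite ler_wpM2r//; lra.
case: ifP => [/hC2 /le_trans|_]; [apply|apply: le_trans (hC3 r) _];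
  by rewrite ler_wpM2r//; lra.
Qed.

Lemma closure_hull_Qb b : closure (convex_hull (Mb b)) `<=` Qb b.
Proof.
move=> x xcl; split.
  (* Each coordinate form is bounded with constant [(weight r)^-1], so its nonnegativity passes from
     [Mb b] to the closure of the hull. *)
  have w0 r r' : ((r == r')%:R : R) <= (weight r)^-1 * weight r'.
    have [->|_] := eqVneq r r'; first by rewrite mulVf// gt_eqF ?weight_gt0.
    by rewrite mulr_ge0// ?invr_ge0 ltW ?weight_gt0.
  have w0' r r' : 0 <= (weight r)^-1 * weight r' :> R.
    by rewrite mulr_ge0// ?invr_ge0 ltW ?weight_gt0.
  split => r.
    rewrite -[leRHS]/(coord1 r x) -(plin_rays x) plin_comp.
    apply: (closure_hull_ge (C := (weight r)^-1) _ _ _ xcl).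
    + move=> r'; rewrite -[X in `|X|]/((r == r')%:R : R) normr_nat.
      exact: w0.
    + by move=> r'; rewrite -[X in `|X|]/(0 : R) normr0; exact: w0'.
    + by move=> y /Mb_nonneg[y1 _]; rewrite -plin_comp plin_rays; exact: y1.
  rewrite -[leRHS]/(coord2 r x) -(plin_rays x) plin_comp.
  apply: (closure_hull_ge (C := (weight r)^-1) _ _ _ xcl).
  + by move=> r'; rewrite -[X in `|X|]/(0 : R) normr0; exact: w0'.
  + by move=> r'; rewrite -[X in `|X|]/((r == r')%:R : R) normr_nat; exact: w0.
  + by move=> y /Mb_nonneg[_ y2]; rewrite -plin_comp plin_rays; exact: y2.
move=> psi pi a [_ valid]; rewrite halfspaceE.
pose h : {linear fspair R n -> R^o} := plin (psi : _ -> R^o) (pi : _ -> R^o).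
have [A [xA _]] := supported_fset x.
have [C [C1 C2]] := axproj_bounded h A.
rewrite -(axproj_id xA) -[leRHS]/(h (axproj A x)) /axproj plin_comp.
apply: (closure_hull_ge C1 C2 _ xcl) => y yb.
rewrite -plin_comp -[leRHS]/(h (axproj A y)) -halfspaceE.
exact/valid/Mb_axproj.
Qed.

(** Adding [u] may move the total off [b + Z^n]; one continuous ray repairs this at a cost
    independent of [u]. *)
Lemma Mb_translate b x u : Mb b x -> (forall r, 0 <= (coord1 r u : R)) ->
  (forall p, (coord2 p u : R) \is a Num.nat) ->
  exists2 q : fspair R n, Mb b (x + u + q) & `|q| <= 1 + Num.sqrt n%:R.
Proof.
move=> /MbE[x1 x2 xz] u1 u2.
(* Adding [q] rounds the total of [u] down to an integer vector. *)
pose q : 'rV[R]_n := \row_i ((Num.floor (ray_sum u 0 i))%:~R - ray_sum u 0 i).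
exists (ray q).
  apply/MbE; split.
  - move=> r; rewrite !linearD; apply: addr_ge0; last exact: ler0n.
    by apply: addr_ge0; [exact: x1|exact: u1].
  - move=> r; rewrite !linearD; apply: rpredD; last exact: rpred0.
    by apply: rpredD; [exact: x2|exact: u2].
  - rewrite !linearD /= [ray_sum (ray q)]plin_ray.
    have -> : ray_sum x + ray_sum u + q - b = (ray_sum x - b) + (ray_sum u + q).
      by rewrite -(addrA (ray_sum x)) addrAC.
    apply/mxOverP => i j.
    rewrite mxE rpredD//; first exact: (mxOverP xz).
    by rewrite !mxE ord1 addrC subrK intr_int.
(* The 1 covers the indicator of [q = 0]; [Num.sqrt n%:R] covers the Euclidean norm, the entries of
   [q] lying between -1 and 0. *)
rewrite norm_ray /weight lerD//; first by case: (q == 0).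
apply: ler_wsqrtr; apply: (@le_trans _ _ (\sum_(i < n) 1)); last first.
  by rewrite sumr_const card_ord.
apply: ler_sum => i _; rewrite mxE.
have /andP[] := floor_itv (ray_sum u 0 i); rewrite intrD.
set y := ray_sum u 0 i; set f := _%:~R => fy yf.
by rewrite -sqrrN opprB -[leRHS](expr1n _ 2) lerXn2r ?nnegrE//; lra.
Qed.

Lemma closure_hull_add_dir b (e : fspair R n) (l : R) : 0 <= l ->
  (forall r, 0 <= (coord1 r e : R)) ->
  (forall p, (coord2 p e : R) \is a Num.nat) ->
  forall x, closure (convex_hull (Mb b)) x ->
  closure (convex_hull (Mb b)) (x + l *: e).
Proof.
move=> l0 e1 e2; apply: closure_translate.
(* The points whose translate lies in the closure form a convex set, so only points of [Mb b]
   matter. *)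
apply: convex_hull_sub => [x y t t01 xc yc|x xb].
  have -> : t *: x + (1 - t) *: y + l *: e =
      t *: (x + l *: e) + (1 - t) *: (y + l *: e).
    by rewrite !scalerDr [RHS]addrACA -scalerDl [t + _]addrC subrK scale1r.
  by apply: closure_conv => //; exact: convex_hull_conv.
apply/closure_normP => eps eps0; pose B : R := 1 + Num.sqrt n%:R.
have B0 : 0 < B by rewrite ltr_pwDl ?sqrtr_ge0.
(* [N] exceeds [l], so that the weight [t = l / N] is at most 1, and exceeds [l * B / eps], so that
   the error [t *: q] has norm below [eps]. *)
pose N := (Num.truncn (l + l * B / eps)).+1.
have lN : l + l * B / eps < N%:R by rewrite truncnS_gt.
have N0 : 0 < N%:R :> R by rewrite ltr0n.
have lB0 : 0 <= l * B / eps by rewrite divr_ge0 ?mulr_ge0 ?(ltW B0) ?(ltW eps0).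
have [||q qb qB] := @Mb_translate b x (N%:R *: e) xb.
- by move=> r; rewrite linearZ; apply: mulr_ge0; [exact: ltW|exact: e1].
- by move=> r; rewrite linearZ; apply: rpredM; [exact: rpred_nat|exact: e2].
pose t := l / N%:R.
have t0 : 0 <= t by rewrite divr_ge0// ltW.
have t1 : t <= 1 by rewrite ler_pdivrMr// mul1r; lra.
exists (t *: (x + N%:R *: e + q) + (1 - t) *: x).
  by apply: convex_hull_conv; rewrite ?t0 ?t1//; exact: sub_convex_hull.
have -> : t *: (x + N%:R *: e + q) + (1 - t) *: x = x + l *: e + t *: q.
  rewrite !scalerDr scalerBl scale1r scalerA divfK ?gt_eqF//.
  by rewrite addrC !addrA subrK.
rewrite opprD addNKr normrN normrZ ger0_norm//.
apply: le_lt_trans (ler_wpM2l t0 qB) _.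
rewrite -/B /t mulrAC ltr_pdivrMr// [eps * _]mulrC -ltr_pdivrMr//; lra.
Qed.

(** An element of the cone is a finite sum of nonnegative multiples of rays, and the translations
    [D] that preserve the closure are stable under sums. *)
Lemma closure_hull_add_cone b x c : closure (convex_hull (Mb b)) x ->
  nonneg_cone c -> closure (convex_hull (Mb b)) (x + c).
Proof.
move=> xc [c1 c2].
pose D := [set c | forall x, closure (convex_hull (Mb b)) x ->
  closure (convex_hull (Mb b)) (x + c)].
suff : D c by apply.
have D0 : D 0 by move=> y; rewrite addr0.
have DD u v : D u -> D v -> D (u + v) by move=> Du Dv y /Du/Dv; rewrite addrA.
have Dray l r : 0 <= l -> D (l *: ray r).
  move=> l0 y; apply: closure_hull_add_dir => // p; exact: rpred0.
have Dpray l r : 0 <= l -> D (l *: pray r).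
  move=> l0 y; apply: closure_hull_add_dir => // p; exact: rpred_nat.
rewrite -(plin_rays c).
have [A1 cA1] := fset_supp c.1; have [A2 cA2] := fset_supp c.2.
apply: (DD _ _); [rewrite (fslinE _ cA1)|rewrite (fslinE _ cA2)];
  apply: (big_ind _ D0 DD) => r _; [exact: Dray|exact: Dpray].
Qed.

Lemma hull_cone_closure b :
  minkowski_sum (convex_hull (Mb b)) nonneg_cone `<=`
  closure (convex_hull (Mb b)).
Proof.
move=> _ [x xh [c c0 <-]]; apply: closure_hull_add_cone => //.
exact: subset_closure.
Qed.

End inclusions.

(** * Closedness of the integrality and linear constraints *)

Lemma closed_int (R : realType) : closed [set x : R | x \is a Num.int].
Proof.
move=> x /(@closure_normP R R^o) xcl /=; apply: contrapT => xint.
have /andP[fx xf] := floor_itv x.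
have {}fx : (Num.floor x)%:~R < x.
  rewrite lt_neqAle fx andbT; apply/eqP => xE; apply: xint.
  by rewrite -xE intr_int.
(* The radius is the distance from [x] to the nearer of its two neighbouring integers, so no integer
   is closer. *)
have [|a /intrP[m ->]] :=
    xcl (Num.min (x - (Num.floor x)%:~R) ((Num.floor x + 1)%:~R - x)).
  by rewrite lt_min !subr_gt0 fx.
rewrite lt_min => /andP[fm mf].
have := le_lt_trans (ler_norm _) fm; rewrite ltrD2l ltrN2 ltr_int => {}fm.
rewrite distrC in mf; have := le_lt_trans (ler_norm _) mf.
by rewrite ltrD2r ltr_int ltzD1 leNgt fm.
Qed.

Lemma closed_nat (R : realType) : closed [set x : R | x \is a Num.nat].
Proof.
rewrite (_ : mkset _ = [set x | x \is a Num.int] `&` [set x | 0 <= x]).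
  by apply: closedI; [exact: closed_int|exact: closed_ge].
by apply/seteqP; split => x /=; rewrite natrEint => /andP.
Qed.

Lemma closed_dotr (R : realType) d (w : 'rV[R]_d) (A : set R) :
  closed A -> closed [set v | A (dotr w v)].
Proof. exact: ((continuous_closedP (dotr w)).1 (@dotr_continuous R d w)). Qed.

Lemma closed_forall (T : topologicalType) I (P : I -> set T) :
  (forall i, closed (P i)) -> closed [set x | forall i, P i x].
Proof.
move=> Pcl; rewrite (_ : mkset _ = \bigcap_(i in [set: I]) P i).
  by apply: closed_bigI => i _; exact: Pcl.
by apply/seteqP; split => x Px; [move=> i _; exact: Px|move=> i; exact: Px].
Qed.

(** * Coordinates on the points supported in a finite set, and separation there *)

Section finite_support.
Variables (R : realType) (n : nat).
Implicit Types (x : fspair R n) (b : 'rV[R]_n) (A : {fset 'rV[R]_n}).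

(** Indexes the coordinates of the points supported in [A]: the tag [true] marks continuous rays,
    [false] integer ones. *)
Definition unit_seq A : seq (bool * 'rV[R]_n) :=
  [seq (true, r) | r <- A] ++ [seq (false, p) | p <- A].

Definition unit_ray (e : bool * 'rV[R]_n) : fspair R n :=
  if e.1 then ray e.2 else pray e.2.

Definition unit_coord (e : bool * 'rV[R]_n) x : R :=
  if e.1 then coord1 e.2 x else coord2 e.2 x.

Definition of_coords A (v : 'rV[R]_(size (unit_seq A))) : fspair R n :=
  \sum_i v 0 i *: unit_ray (tnth (in_tuple (unit_seq A)) i).

Definition to_coords A x : 'rV[R]_(size (unit_seq A)) :=
  \row_i unit_coord (tnth (in_tuple (unit_seq A)) i) x.

Lemma of_coordsP A : linear (@of_coords A).
Proof.
move=> a u v; rewrite /of_coords scaler_sumr -big_split.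
by apply: eq_bigr => i _ /=; rewrite !mxE scalerA -scalerDl.
Qed.

Lemma to_coordsP A : linear (@to_coords A).
Proof.
move=> a x y; apply/rowP => i; rewrite !mxE /unit_coord; case: ifP => _;
  by rewrite linearP.
Qed.

HB.instance Definition _ A :=
  GRing.isLinear.Build R 'rV[R]_(size (unit_seq A)) (fspair R n) *:%R
    (@of_coords A) (@of_coordsP A).
HB.instance Definition _ A :=
  GRing.isLinear.Build R (fspair R n) 'rV[R]_(size (unit_seq A)) *:%R
    (@to_coords A) (@to_coordsP A).

Lemma of_coordsK A x : supported A x -> of_coords (to_coords A x) = x.
Proof.
move=> [x1 x2]; rewrite /of_coords.
under eq_bigr do rewrite mxE.
rewrite -(big_tnth _ _ (unit_seq A) xpredT
  (fun e => unit_coord e x *: unit_ray e)).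
rewrite big_cat !big_map /= -[RHS]plin_rays /plin.
by congr (_ + _); rewrite (@fslinE _ _ _ _ _ A).
Qed.

Lemma linear_of_coordsE A (h : {linear fspair R n -> R^o}) v :
  h (@of_coords A v) =
  dotr (\row_i h (unit_ray (tnth (in_tuple (unit_seq A)) i))) v.
Proof.
by rewrite linear_sum; apply: eq_bigr => i _; rewrite linearZ mxE mulrC.
Qed.

Definition Mb_coords A b : set 'rV[R]_(size (unit_seq A)) :=
  orthant `&` [set v | Mb b (of_coords v)].

(** In finite dimension every linear form is a dot product, hence continuous, and each condition is
    a preimage of a closed set of reals. *)
Lemma closed_Mb_coords A b : closed (@Mb_coords A b).
Proof.
have cl (h : {linear fspair R n -> R^o}) (C : set R) : closed C ->
    closed [set v : 'rV[R]_(size (unit_seq A)) | C (h (of_coords v))].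
  move=> /closed_dotr Ccl; under eq_set do rewrite linear_of_coordsE.
  exact: Ccl.
apply: closedI.
  apply: closed_forall => i.
  exact: ((continuous_closedP _).1 (@coord_continuous R 1 _ 0 i)
    _ (@closed_ge R 0)).
rewrite (_ : mkset _ =
  [set v | forall r, 0 <= (coord1 r (of_coords v) : R)] `&`
  ([set v | forall p, (coord2 p (of_coords v) : R) \is a Num.nat] `&`
   [set v | forall j, ray_sum (of_coords v) 0 j - b 0 j \is a Num.int]));
  last first.
  apply/seteqP; split => v /=.
    move=> /MbE[v1 v2 vz]; split=> //; split=> // j.
    by have /mxOverP/(_ 0 j) := vz; rewrite !mxE.
  move=> [v1 [v2 vz]]; apply/MbE; split => //; apply/mxOverP => i j.
  by rewrite mxE [X in _ + X]mxE ord1; exact: vz.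
apply: closedI.
  by apply: closed_forall => r; exact: (cl (coord1 r) _ (@closed_ge R 0)).
apply: closedI.
  by apply: closed_forall => p; exact: (cl (coord2 p) _ (@closed_nat R)).
apply: closed_forall => j.
pose h : fspair R n -> R^o := fun x => ray_sum x 0 j.
have hP : linear h by move=> a x y; rewrite /h linearP !mxE.
pose hL := GRing.isLinear.Build R (fspair R n) R^o *:%R h hP.
pose H : {linear fspair R n -> R^o} := HB.pack h hL.
apply: (cl H [set y | y - b 0 j \is a Num.int]).
apply: ((continuous_closedP (fun y : R => y - b 0 j)).1 _ _ (@closed_int R)).
by move=> y; apply: continuousB; [exact: cvg_id|exact: cst_continuous].
Qed.

(** Mixing two combinations doubles the number of points; [caratheodory] brings it back to the fixed
    one. *)
Lemma minkowski_conv A b :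
  let K := minkowski_sum
    (convex_comb (@Mb_coords A b) (size (unit_seq A)).+1) orthant in
  forall u v t, K u -> K v -> 0 <= t <= 1 -> K (t *: u + (1 - t) *: v).
Proof.
move=> K _ _ t [u uc [u' u'0 <-]] [v vc [v' v'0 <-]] t01.
exists (t *: u + (1 - t) *: v).
  exact: (caratheodory (convex_comb_conv t01 uc vc)).
exists (t *: u' + (1 - t) *: v').
  move/andP: t01 => [t0 t1] i; rewrite !mxE.
  by rewrite addr_ge0 ?mulr_ge0 ?subr_ge0.
by rewrite !scalerDr addrACA.
Qed.

Lemma to_coords_Mb A b x : (forall r i, axis r i \in A) -> Mb b x ->
  Mb_coords b (to_coords A (axproj A x)).
Proof.
move=> axA xb; have pxb := Mb_axproj A xb.
split; last by rewrite /= of_coordsK//; exact: supported_axproj.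
have [p1 p2] := Mb_nonneg pxb.
by move=> i; rewrite mxE /unit_coord; case: ifP => _; [exact: p1|exact: p2].
Qed.

Lemma convex_comb_linear (V W : lmodType R) (h : {linear V -> W}) (S : set V)
    m v :
  convex_comb S m v -> convex_comb (h @` S) m (h v).
Proof.
move=> [l [s [l0 l1 sS ->]]]; exists l, (h \o s); split => //.
  by move=> i; exists (s i).
by rewrite linear_sum; apply: eq_bigr => i _; rewrite linearZ.
Qed.

Lemma of_coords_ge0 A v : orthant v -> nonneg_cone (@of_coords A v).
Proof.
move=> v0; split => r.
  rewrite -[leRHS]/(coord1 r (of_coords v)) linear_sum sumr_ge0// => i _.
  rewrite linearZ; apply: mulr_ge0; first exact: v0.
  by rewrite /unit_ray; case: ifP => _ //; exact: ler0n.
rewrite -[leRHS]/(coord2 r (of_coords v)) linear_sum sumr_ge0// => i _.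
rewrite linearZ; apply: mulr_ge0; first exact: v0.
by rewrite /unit_ray; case: ifP => _ //; exact: ler0n.
Qed.

(** One unit of the ray [b] has total [b]. The nearest-point argument needs a nonempty set. *)
Lemma Mb_neq0 b : exists x, Mb b x.
Proof.
exists (ray b); apply/MbE; split.
- by move=> r; exact: ler0n.
- by move=> p; exact: rpred0.
- rewrite [ray_sum _]plin_ray subrr; apply/mxOverP => i j.
  by rewrite mxE rpred0.
Qed.

(** Dividing by [|a|] when [a] is nonzero normalises the right-hand side to -1, 0 or 1, as valid
    tuples demand. *)
Lemma valid_halfspace b (psi pi : 'rV[R]_n -> R) a x : Qb b x ->
  Mb b `<=` halfspace psi pi a -> halfspace psi pi a x.
Proof.
move=> [_ xQ] valid.
pose c := if a == 0 then 1 else `|a|^-1.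
have c0 : 0 < c.
  by rewrite /c; case: eqVneq => // a0; rewrite invr_gt0 normr_gt0.
have cE y : halfspace (fun r => c * psi r) (fun r => c * pi r) (c * a) y =
    halfspace psi pi a y.
  rewrite !halfspaceE -(ler_pM2l c0 a); congr (is_true (_ <= _)).
  exact: esym (plin_comp (psi : _ -> R^o) (pi : _ -> R^o) ( *:%R c) y).
rewrite -cE; apply: xQ; split; last by move=> y /valid; rewrite cE.
rewrite /c; have [->|a0] := eqVneq a 0; first by rewrite mulr0 !inE eqxx orbT.
rewrite mulrC {1}[a]numEsg mulfK ?normr_eq0// !inE.
by case: sgrP; rewrite eqxx ?orbT.
Qed.

Lemma Qb_hull_cone b : Qb b `<=` minkowski_sum (convex_hull (Mb b)) nonneg_cone.
Proof.
move=> x xQ; have [A [xA axA]] := supported_fset x.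
pose d := size (unit_seq A).
pose K := minkowski_sum (convex_comb (@Mb_coords A b) d.+1) orthant.
(* If the coordinates of [x] lie in [K], mapping the decomposition back by [of_coords] gives the one
   sought. *)
have [[u uc [v v0 uvx]]|xK] := pselect (K (to_coords A x)).
  exists (of_coords u).
    have := convex_comb_hull (convex_comb_linear (@of_coords A) uc).
    apply: convex_hull_sub => [|_ [w [_ wb] <-]].
      exact: convex_hull_conv.
    exact: sub_convex_hull.
  exists (of_coords v); first exact: of_coords_ge0.
  by rewrite -linearD /= uvx of_coordsK.
have sub_K : @Mb_coords A b `<=` K.
  move=> v vM; exists v; last first.
    by exists 0; [move=> i; rewrite mxE|rewrite addr0].
  apply: (@caratheodory _ _ 1); exists (fun=> 1), (fun=> v); split => //.
  - by rewrite big_ord1.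
  - by rewrite big_ord1 scale1r.
have Kcl : closed K.
  by apply: closed_convex_comb_orthant; [exact: closed_Mb_coords|move=> v []].
have K0 : K !=set0.
  have [y yb] := Mb_neq0 b; exists (to_coords A (axproj A y)).
  exact/sub_K/to_coords_Mb.
have [w [a [wx wK]]] :=
  closed_convex_separation Kcl K0 (@minkowski_conv A b) xK.
pose h : fspair R n -> R^o := fun y => dotr w (to_coords A (axproj A y)).
have hP : linear h by move=> c y z; rewrite /h !linearP dotrDr dotrZr.
pose hL := GRing.isLinear.Build R (fspair R n) R^o *:%R h hP.
pose H : {linear fspair R n -> R^o} := HB.pack h hL.
(* The tuple is read off from the values of [H] on the two kinds of rays. *)
have HE y : H y = plin (H \o @ray R n) (H \o @pray R n) y.
  by rewrite -plin_comp plin_rays.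
have := @valid_halfspace b (H \o @ray R n) (H \o @pray R n) a x xQ.
rewrite halfspaceE -HE => /(_ _)/wrap[|aH].
  move=> y yb; rewrite halfspaceE -HE.
  exact/wK/sub_K/to_coords_Mb.
(* The projection fixes [x], so both sides are equal: a contradiction. *)
have : dotr w (to_coords A x) < H x by exact: lt_le_trans wx aH.
by rewrite -[X in _ < X]/(dotr w (to_coords A (axproj A x))) axproj_id// ltxx.
Qed.

End finite_support.

Theorem theorem2p14 (R : realType) (n : nat) (b : 'rV[R]_n) (hb : ~ Zn b) :
  Qb b = closure (convex_hull (Mb b)) /\
  closure (convex_hull (Mb b)) = minkowski_sum (convex_hull (Mb b)) nonneg_cone.
Proof.
have QK := @Qb_hull_cone R n b.
have KC := @hull_cone_closure R n b.
have CQ := @closure_hull_Qb R n b.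
split; apply/seteqP; split => //.
- by move=> x /QK/KC.
- by move=> x /CQ/QK.
Qed.
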